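(* Let $\alpha\ge0$ and $1<p,q<\infty$. Then: (i) if $p=q$, then $F^{\alpha}_{p,p}(\gamma_d)=B^{\alpha}_{p,p}(\gamma_d)$; (ii) if $q>p$, then $F^{\alpha}_{p,q}(\gamma_d)\subset B^{\alpha}_{p,q}(\gamma_d)$; (iii) if $p>q$, then $B^{\alpha}_{p,q}(\gamma_d)\subset F^{\alpha}_{p,q}(\gamma_d)$.
   Context: $\gamma_d$ is the Gaussian probability measure on $\mathbb{R}^d$ with density $\pi^{-d/2}e^{-|x|^2}$, and $\|\cdot\|_{p,\gamma_d}$ is the norm of $L^p(\gamma_d)$. Ornstein-Uhlenbeck semigroup: $T_tf(x)=\pi^{-d/2}(1-e^{-2t})^{-d/2}\int_{\mathbb{R}^d}e^{-|y-e^{-t}x|^2/(1-e^{-2t})}f(y)\,dy$ for $t>0$, $T_0f=f$. Poisson-Hermite semigroup: $P_tf(x)=\int_0^\infty T_sf(x)\,\mu_t^{(1/2)}(ds)$ for $t>0$, where $\mu^{(1/2)}_t(ds)=\frac{t}{2\sqrt{\pi}}\frac{e^{-t^2/4s}}{s^{3/2}}ds$ on $(0,\infty)$; $P_0f=f$. Gaussian Besov-Lipschitz spaces: let $\alpha\ge0$, $k$ the smallest integer greater than $\alpha$, $1\le p\le\infty$, $1\le q<\infty$. $B^{\alpha}_{p,q}(\gamma_d)$ is the set of $f\in L^p(\gamma_d)$ with $\left(\int_0^\infty\left(t^{k-\alpha}\left\|\frac{\partial^kP_tf}{\partial t^k}\right\|_{p,\gamma_d}\right)^q\frac{dt}{t}\right)^{1/q}<\infty$.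 Gaussian Triebel-Lizorkin spaces: let $\alpha\ge0$, $k$ the smallest integer greater than $\alpha$, $1\le p,q<\infty$. $F^{\alpha}_{p,q}(\gamma_d)$ is the set of $f\in L^p(\gamma_d)$ with $\left\|\left(\int_0^\infty\left(t^{k-\alpha}\left|\frac{\partial^kP_tf}{\partial t^k}\right|\right)^q\frac{dt}{t}\right)^{1/q}\right\|_{p,\gamma_d}<\infty$. *)

(* Defs.v *)
From HB Require Import structures.
From mathcomp Require Import all_boot all_order all_algebra.
From mathcomp Require Import all_classical all_reals all_analysis.
From mathcomp Require Import measurable_realfun.
From mathcomp Require Import ring.

Set Implicit Arguments.
Unset Strict Implicit.
Unset Printing Implicit Defensive.

Import Order.TTheory GRing.Theory Num.Theory.
Import numFieldNormedType.Exports.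

Local Open Scope classical_set_scope.
Local Open Scope ring_scope.

(* R^d is [d.-tuple R], with the product sigma-algebra of the library. The    *)
(* Lebesgue measure [lebesgue_tuple d] on it is built one coordinate at a     *)
(* time from the binary product of measures.                                  *)

Definition tuple_cons {R : realType} {n : nat} (z : R * n.-tuple R) :
  n.+1.-tuple R := [tuple of z.1 :: z.2].

Lemma measurable_tuple_cons (R : realType) (n : nat) :
  measurable_fun setT (@tuple_cons R n).
Proof. exact: measurable_cons. Qed.

Section lebesgue_cons.
Context {R : realType} (n : nat)
  (m : {sigma_finite_measure set (n.-tuple R) -> \bar R}).

Definition lebesgue_cons : set (n.+1.-tuple R) -> \bar R :=
  pushforward (@lebesgue_measure R \x m)%E tuple_cons.

Let lebesgue_cons_measure : {measure set (n.+1.-tuple R) -> \bar R} :=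
  measure_function_pushforward__canonical__measure_function_Measure
    (@lebesgue_measure R \x m)%E (@measurable_tuple_cons R n).

Let lebesgue_cons0 : lebesgue_cons set0 = 0%E.
Proof. exact: (measure0 lebesgue_cons_measure). Qed.

Let lebesgue_cons_ge0 A : (0 <= lebesgue_cons A)%E.
Proof. exact: (measure_ge0 lebesgue_cons_measure). Qed.

Let lebesgue_cons_additive : semi_sigma_additive lebesgue_cons.
Proof. exact: (@measure_semi_sigma_additive _ _ _ lebesgue_cons_measure). Qed.

HB.instance Definition _ := isMeasure.Build _ _ _ lebesgue_cons
  lebesgue_cons0 lebesgue_cons_ge0 lebesgue_cons_additive.

Let lebesgue_cons_sigma_finite : sigma_finite setT lebesgue_cons.
Proof.
have [F TF Ffin] : sigma_finite setT (@lebesgue_measure R \x m)%E.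
  have /sigma_finiteP[F [TF ndF Foo]] := sigma_finiteT (@lebesgue_measure R).
  have /sigma_finiteP[G [TG ndG Goo]] := sigma_finiteT m.
  exists (fun k => F k `*` G k).
    rewrite -setXTT TF TG predeqE => -[x y]; split; last first.
      by move=> [k _ []/= ? ?]; split; exists k.
    move=> [/= [i _ Fix] [j _ Gjy]]; exists (maxn i j) => //; split.
    - by move: x Fix; exact/subsetPset/ndF/leq_maxl.
    - by move: y Gjy; exact/subsetPset/ndG/leq_maxr.
  move=> k; have [? ?] := Foo k; have [? ?] := Goo k.
  split; first exact: measurableX.
  by rewrite product_measure1E// lte_mul_pinfty// ge0_fin_numE.
pose uncons (t : n.+1.-tuple R) : R * n.-tuple R := (thead t, [tuple of behead t]).
have muncons : measurable_fun setT uncons.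
  by apply/measurable_fun_pair; [exact: measurable_tnth|exact: measurable_behead].
have unconsK z : uncons (tuple_cons z) = z.
  by case: z => a t; congr pair; exact: val_inj.
exists (fun k => uncons @^-1` F k).
  by rewrite -preimage_bigcup -TF preimage_setT.
move=> k; have [mF Foo] := Ffin k; split.
  by rewrite -[X in measurable X]setTI; exact: muncons.
rewrite /lebesgue_cons /pushforward -comp_preimage.
by rewrite (_ : uncons \o tuple_cons = id) //; exact/funext.
Qed.

HB.instance Definition _ := @Measure_isSigmaFinite.Build _ _ _ lebesgue_cons
  lebesgue_cons_sigma_finite.

End lebesgue_cons.

Fixpoint lebesgue_tuple {R : realType} (d : nat) :
    {sigma_finite_measure set (d.-tuple R) -> \bar R} :=
  match d with
  | 0 => \d_[tuple]
  | n.+1 => lebesgue_cons (lebesgue_tuple n)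
  end.

Definition sqnorm {R : realType} {d : nat} (u : 'I_d -> R) : R :=
  \sum_(i < d) u i ^+ 2.

Lemma sqnorm_cons (R : realType) (n : nat) (z : R * n.-tuple R) :
  sqnorm (tnth (tuple_cons z)) = z.1 ^+ 2 + sqnorm (tnth z.2).
Proof.
rewrite /sqnorm big_ord_recl tnth0; congr (_ + _).
by apply: eq_bigr => i _; rewrite tnthS.
Qed.

Definition gaussian_density {R : realType} {d : nat} (x : d.-tuple R) : R :=
  pi `^ (- (d%:R / 2)) * expR (- sqnorm (tnth x)).

Definition gaussian_measure (R : realType) (d : nat) :
    set (d.-tuple R) -> \bar R :=
  fun A => (\int[lebesgue_tuple d]_(x in A) (gaussian_density x)%:E)%E.
Arguments gaussian_measure R d _ : clear implicits.

Section gaussian_measure_instances.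
Context {R : realType}.

Lemma gaussian_density_ge0 d (x : d.-tuple R) : 0 <= gaussian_density x.
Proof. by rewrite mulr_ge0 ?powR_ge0 ?expR_ge0. Qed.

Lemma measurable_gaussian_density d :
  measurable_fun setT (@gaussian_density R d).
Proof.
apply: measurable_funM => //; apply: measurableT_comp => //.
apply: measurableT_comp => //; apply: measurable_sum => i.
by apply: measurable_funX; exact: measurable_tnth.
Qed.

Let gaussian_measure0 d : gaussian_measure R d set0 = 0%E.
Proof. exact: integral_set0. Qed.

Let gaussian_measure_ge0 d A : (0 <= gaussian_measure R d A)%E.
Proof. by apply: integral_ge0 => x _; rewrite lee_fin gaussian_density_ge0. Qed.

Let gaussian_measure_additive d : semi_sigma_additive (gaussian_measure R d).
Proof.
apply: semi_sigma_additive_nng_induced => [|x].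
  by apply/measurable_EFinP; exact: measurable_gaussian_density.
by rewrite lee_fin gaussian_density_ge0.
Qed.

HB.instance Definition _ d := isMeasure.Build _ _ _ (gaussian_measure R d)
  (@gaussian_measure0 d) (@gaussian_measure_ge0 d) (@gaussian_measure_additive d).

Let gaussian_measureT d : gaussian_measure R d setT = 1%E.
Proof.
rewrite /gaussian_measure; elim: d => [|n IHn].
  rewrite integral_dirac//=; last first.
    by apply/measurable_EFinP; exact: measurable_gaussian_density.
  rewrite diracT mul1e /gaussian_density /sqnorm big_ord0 mul0r oppr0 powRr0.
  by rewrite expR0 mulr1.
have mE := @measurable_gaussian_density.
rewrite /= ge0_integral_pushforward//=; last 3 first.
- exact: measurable_tuple_cons.
- by apply/measurable_EFinP; exact: mE.
- by move=> x _; rewrite lee_fin gaussian_density_ge0.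
rewrite preimage_setT fubini_tonelli1//=; last 2 first.
- apply/measurable_EFinP.
  apply: (measurableT_comp (mE _)); exact: measurable_tuple_cons.
- by move=> x; rewrite lee_fin gaussian_density_ge0.
rewrite /fubini_F /=.
transitivity (\int[lebesgue_measure]_x
    ((pi `^ (- (1 / 2)))%:E * (gauss_fun (x : R))%:E))%E.
  apply: eq_integral => x _.
  transitivity (\int[lebesgue_tuple n]_y
    ((pi `^ (- (1 / 2)) * gauss_fun x)%:E * (gaussian_density y)%:E))%E.
    apply: eq_integral => y _; rewrite -EFinM; congr EFin.
    rewrite /gaussian_density sqnorm_cons /= opprD expRD /gauss_fun.
    have -> : - ((n.+1)%:R / 2) = - (1 / 2) + - (n%:R / 2) :> R.
      by rewrite -natr1; field.
    rewrite powRD; last by rewrite (gt_eqF (pi_gt0 R)) implybT.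
    by ring.
  rewrite ge0_integralZl//=.
  - by rewrite IHn mule1 EFinM.
  - by apply/measurable_EFinP; exact: mE.
  - by move=> y _; rewrite lee_fin gaussian_density_ge0.
  - by rewrite lee_fin mulr_ge0 ?powR_ge0 ?gauss_fun_ge0.
rewrite ge0_integralZl//=.
- rewrite integralT_gauss -EFinM -powR12_sqrt ?pi_ge0// -powRD; last first.
    by rewrite (gt_eqF (pi_gt0 R)) implybT.
  by rewrite [X in _ `^ X](_ : _ = 0) ?powRr0//; field.
- by apply/measurable_EFinP; exact: measurable_gauss_fun.
- by move=> x _; rewrite lee_fin gauss_fun_ge0.
- by rewrite lee_fin powR_ge0.
Qed.

HB.instance Definition _ d :=
  @Measure_isProbability.Build _ _ R (gaussian_measure R d) (gaussian_measureT d).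

End gaussian_measure_instances.

(* At t <= 0 both semigroups are set to the identity; only t > 0 and t = 0    *)
(* are meaningful.                                                            *)

Definition ornstein_uhlenbeck {R : realType} {d : nat} (t : R)
    (f : d.-tuple R -> R) (x : d.-tuple R) : R :=
  if 0 < t then
    pi `^ (- (d%:R / 2)) * (1 - expR (- 2 * t)) `^ (- (d%:R / 2)) *
    \int[lebesgue_tuple d]_y
      (expR (- sqnorm (fun i => tnth y i - expR (- t) * tnth x i)
               / (1 - expR (- 2 * t))) * f y)
  else f x.

(* Density on ]0, +oo[ of the one-sided stable measure mu_t^(1/2).            *)
Definition half_stable_density {R : realType} (t s : R) : R :=
  t / (2 * Num.sqrt pi) * (expR (- t ^+ 2 / (4 * s)) / s `^ (3 / 2)).

Definition poisson_hermite {R : realType} {d : nat} (t : R)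
    (f : d.-tuple R -> R) (x : d.-tuple R) : R :=
  if 0 < t then
    \int[lebesgue_measure]_(s in `]0, +oo[)
      (ornstein_uhlenbeck s f x * half_stable_density t s)
  else f x.

Definition dt_poisson_hermite {R : realType} {d : nat} (k : nat)
    (f : d.-tuple R -> R) (t : R) (x : d.-tuple R) : R :=
  derive1n k (fun u : R => poisson_hermite u f x) t.

Definition smoothness_order {R : realType} (alpha : R) : nat :=
  (Num.truncn alpha).+1.

Lemma smoothness_orderP (R : realType) (alpha : R) : 0 <= alpha ->
  alpha < (smoothness_order alpha)%:R /\
  (forall n : int, alpha < n%:~R -> (smoothness_order alpha)%:Z <= n).
Proof.
move=> a0; split; first exact: truncnS_gt.
case=> n /= an; last first.
  suff : alpha < 0 by rewrite ltNge a0.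
  by apply: lt_trans an _; rewrite ltrz0.
by rewrite lez_nat /smoothness_order truncn_lt_nat.
Qed.

(* Elements of L^p are represented by measurable functions; P_t f (t > 0),    *)
(* hence membership below, only depends on the almost-everywhere class of f.  *)

Definition besov_lipschitz {R : realType} {d : nat} (alpha : R) (p : \bar R)
    (q : R) : set (d.-tuple R -> R) :=
  let k := smoothness_order alpha in
  [set f | f \in Lfun (gaussian_measure R d) p /\
    ((\int[lebesgue_measure]_(t in `]0%R, +oo[)
        (((t `^ (k%:R - alpha))%:E *
          'N[gaussian_measure R d]_p[EFin \o dt_poisson_hermite k f t]) `^ q
         * (t^-1)%:E)) `^ q^-1 < +oo)%E].

Definition triebel_lizorkin {R : realType} {d : nat} (alpha p q : R) :
    set (d.-tuple R -> R) :=
  let k := smoothness_order alpha in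
  [set f | f \in Lfun (gaussian_measure R d) p%:E /\
    ('N[gaussian_measure R d]_p%:E[ (fun x =>
        (\int[lebesgue_measure]_(t in `]0%R, +oo[)
           (((t `^ (k%:R - alpha) * `|dt_poisson_hermite k f t x|)%:E) `^ q
            * (t^-1)%:E)) `^ q^-1) ] < +oo)%E].

(* Main.v *)
Require Import Defs.
From mathcomp Require Import all_boot all_order all_algebra.
From mathcomp Require Import all_classical all_reals all_analysis.
From mathcomp Require Import measurable_realfun ring lra.

Import Order.TTheory GRing.Theory Num.Theory.
Import numFieldNormedType.Exports.
Local Open Scope classical_set_scope.
Local Open Scope ring_scope.

(* Put [u(t, x) = t^(k - alpha - 1/q) |d^k/dt^k P_t f(x)|] on [t > 0]. The
   Besov-Lipschitz condition says that the [L^q(dt)] norm of the [L^p(gamma_d)]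
   norm of [u] is finite, the Triebel-Lizorkin condition that the norms taken
   in the other order are finite. So (i) is Tonelli's theorem, and (ii), (iii)
   are Minkowski's integral inequality for [u^p] and [u^q].

   Both need [u] to be jointly measurable. The functions
     [F_j(t, x) = \int_0^oo T_s f(x) s^(- j - 3/2) e^(- t^2 / 4s) ds]
   are jointly measurable and satisfy [dF_j/dt = - (t / 2) F_(j+1)], while
   [P_t f = t F_0 / (2 sqrt pi)], so each [d^k/dt^k P_t f] is a combination of
   the [F_j] with coefficients polynomial in [t]. Differentiation under the
   integral sign rests on
     [|y - e x|^2 / (1 - e^2) >= |y|^2 - |x|^2] for [0 < e < 1],
   which bounds [T_s f(x)] by [C e^(|x|^2) (1 - e^(-2s))^(- d/2)] for [f] in
   [L^1(gamma_d)]. *)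

(** * Minkowski's integral inequality, as a statement about finiteness *)

(** As [a <= b] and [r - 1 > 0], [a^(r-1) <= b^(r-1)]. The exponents are those left by the weighted
    Hoelder inequality below. *)
Lemma powRB1M_le (R : realType) (a b r : R) : 1 < r -> 0 <= a -> a <= b ->
  0 < b -> b `^ (1 - r) * a `^ r <= a.
Proof.
move=> r1 a0 ab b0; rewrite -(@mulr_powRB1 _ a r)//; last exact: lt_trans r1.
rewrite mulrCA -[leRHS]mulr1 ler_wpM2l// -(opprB r 1) powRN mulrC.
rewrite ler_pdivrMr ?powR_gt0// mul1r; apply: ge0_ler_powR => //.
- by rewrite subr_ge0 ltW.
- by rewrite nnegrE ltW.
Qed.

Section integral_minkowski.
Local Open Scope ereal_scope.
Context {R : realType} {d1 d2 : measure_display}.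
Context {X : measurableType d1} {Y : measurableType d2}.
Variables (m1 : {sigma_finite_measure set X -> \bar R})
          (m2 : {sigma_finite_measure set Y -> \bar R}).
Variables (h : X * Y -> R) (w : Y -> R) (r : R).
Hypotheses (mh : measurable_fun setT h) (h0 : forall z, (0 <= h z)%R).
Hypotheses (mw : measurable_fun setT w) (w0 : forall y, (0 < w y)%R).
Hypotheses (iw : \int[m2]_y (w y)%:E < +oo) (r1 : (1 < r)%R).

Let I y := \int[m1]_x (h (x, y) `^ r)%:E.
Let A y := I y `^ r^-1.
(** [fine] replaces an infinite [A y] by 0, which concerns only a null set of [y] as soon as [A] is
    integrable. *)
Let B y := (fine (A y) + w y)%R.

Let r0 : (0 < r)%R. Proof. exact: lt_trans r1. Qed.

Let mhr : measurable_fun setT (fun z => h z `^ r)%R.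
Proof. exact: (measurableT_comp (measurable_powR _)). Qed.

Let mI : measurable_fun setT I.
Proof.
apply: (@measurable_fun_fubini_tonelli_G _ _ _ _ R m1
  (EFin \o (fun z => h z `^ r)%R)).
  exact/measurable_EFinP.
by move=> z; rewrite lee_fin powR_ge0.
Qed.

Let I0 y : 0 <= I y.
Proof. by apply: integral_ge0 => x _; rewrite lee_fin powR_ge0. Qed.

Let mA : measurable_fun setT A.
Proof. exact: (measurableT_comp (measurable_poweR _)). Qed.

Let A0 y : 0 <= A y. Proof. exact: poweR_ge0. Qed.

Let mB : measurable_fun setT B.
Proof. by apply: measurable_funD => //; exact: measurableT_comp. Qed.

Let B0 y : (0 < B y)%R.
Proof. by rewrite ltr_wpDl// fine_ge0. Qed.

(* Hoelder's inequality for the product of [h B^(-1/r')] and [B^(1/r')]; the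
   weight [w] keeps [B] positive where [A] vanishes. *)
Let hoelder_weighted x :
  (\int[m2]_y (h (x, y))%:E) `^ r <=
  (\int[m2]_y (h (x, y) `^ r * B y `^ (1 - r))%:E) *
  (\int[m2]_y (B y)%:E) `^ (r - 1).
Proof.
set s := (1 - r^-1)%R.
have s0 : (0 < s)%R by rewrite subr_gt0 invf_lt1.
have rs : (r * s = r - 1)%R by rewrite /s mulrBr mulr1 divff// gt_eqF.
have mhx : measurable_fun setT (fun y => h (x, y)) by exact: measurableT_comp.
pose f y := (h (x, y) * B y `^ (- s))%R.
pose g y := (B y `^ s)%R.
have mf : measurable_fun setT f.
  apply: measurable_funM => //.
  exact: (measurableT_comp (measurable_powR _)).
have mg : measurable_fun setT g.
  exact: (measurableT_comp (measurable_powR _)).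
have := @hoelder _ _ _ m2 f g r s^-1 mf mg r0.
rewrite invr_gt0 => /(_ s0); rewrite invrK /s addrC subrK => /(_ erefl).
rewrite Lnorm1 -/s.
rewrite (eq_integral (fun y => (h (x, y))%:E)); last first.
  move=> y _; rewrite /= /f /g -mulrA powRN mulVf ?mulr1 ?ger0_norm//.
  by rewrite gt_eqF// powR_gt0.
have H0 : 0 <= \int[m2]_y (h (x, y))%:E.
  by apply: integral_ge0 => y _; rewrite lee_fin.
move=> /(@gt0_ler_poweR _ _ (ltW r0)); rewrite !in_itv/= !leey !andbT.
rewrite mule_ge0 ?Lnorm_ge0// => /(_ H0 isT) /le_trans; apply.
rewrite poweRM ?Lnorm_ge0// poweR_Lnorm ?gt_eqF//.
rewrite le_eqVlt; apply/orP; left; apply/eqP; congr (_ * _).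
  apply: eq_integral => y _; rewrite /f /= ger0_norm ?mulr_ge0 ?powR_ge0//.
  by rewrite powRM ?powR_ge0// -powRrM mulNr (mulrC s) rs opprB.
rewrite unlock invrK -poweRrM (mulrC s) rs; congr (_ `^ _).
apply: eq_integral => y _.
rewrite /g /= ger0_norm ?powR_ge0// -powRrM divff ?gt_eqF//.
by rewrite powRr1// ltW.
Qed.

(** The bound [hoelder_weighted] is integrated over [x] and the order of integration exchanged. Its
    first factor becomes the integral of [B^(1-r) I = B^(1-r) A^r], at most that of [A]; the second
    is a power of the integral of [B], finite because [A] and [w] are integrable. Adding [w] costs
    the sharp constant but not finiteness. *)
Lemma integral_minkowski_lty : \int[m2]_y A y < +oo ->
  \int[m1]_x ((\int[m2]_y (h (x, y))%:E) `^ r) < +oo.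
Proof.
move=> iA.
have iB : \int[m2]_y (B y)%:E < +oo.
  apply: (@le_lt_trans _ _ (\int[m2]_y (A y + (w y)%:E))); last first.
    rewrite ge0_integralD//; first exact: lte_add_pinfty.
    - by move=> y _; rewrite lee_fin ltW.
    - exact/measurable_EFinP.
  apply: ge0_le_integral => //.
  - by move=> y _; rewrite lee_fin ltW.
  - exact/measurable_EFinP.
  - by apply: emeasurable_funD => //; exact/measurable_EFinP.
  - move=> y _; rewrite EFinD leeD2r//.
    by have := A0 y; case: (A y) => //= _; rewrite leey.
have aeA : {ae m2, forall y, A y \is a fin_num}.
  have iAA : m2.-integrable setT A.
    apply/integrableP; split=> //.
    by under eq_integral do rewrite gee0_abs//.
  by apply: filterS (integrable_ae measurableT iAA) => y ; apply.
pose k z := (h z `^ r * B z.2 `^ (1 - r))%R.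
have k0 z : (0 <= k z)%R by rewrite mulr_ge0 ?powR_ge0.
have mBr : measurable_fun setT (fun y => B y `^ (1 - r))%R.
  exact: (measurableT_comp (measurable_powR _)).
have mk : measurable_fun setT k.
  apply: measurable_funM => //.
  exact: (measurableT_comp mBr (@measurable_snd _ _ X Y)).
have mEk : measurable_fun setT (EFin \o k) by exact/measurable_EFinP.
set C := (\int[m2]_y (B y)%:E) `^ (r - 1).
have mkx : measurable_fun setT (fun x => \int[m2]_y (k (x, y))%:E).
  exact: (@measurable_fun_fubini_tonelli_F _ _ _ _ R m2 (EFin \o k)).
apply: (@le_lt_trans _ _ ((\int[m1]_x \int[m2]_y (k (x, y))%:E) * C)).
  rewrite -ge0_integralZr//; last 2 first.
  - by move=> x _; apply: integral_ge0 => y _; rewrite lee_fin.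
  - exact: poweR_ge0.
  apply: ge0_le_integral => //.
  - by move=> x _; exact: poweR_ge0.
  - apply: (measurableT_comp (measurable_poweR _)).
    apply: (@measurable_fun_fubini_tonelli_F _ _ _ _ R m2 (EFin \o h)).
      exact/measurable_EFinP.
    by move=> z; rewrite lee_fin.
  - exact: emeasurable_funM.
apply: lte_mul_pinfty; last exact: poweR_lty.
  by apply: integral_ge0 => x _; apply: integral_ge0 => y _; rewrite lee_fin.
rewrite (@fubini_tonelli _ _ _ _ R m1 m2 (EFin \o k))//.
have kI y : \int[m1]_x (k (x, y))%:E = (B y `^ (1 - r))%:E * I y.
  under eq_integral do rewrite /k /= EFinM muleC.
  rewrite ge0_integralZl//.
  - apply/measurable_EFinP.
    exact: (measurableT_comp mhr (@measurable_pair2 _ _ X Y y)).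
  - by move=> x _; rewrite lee_fin powR_ge0.
  - by rewrite lee_fin powR_ge0.
rewrite ge0_fin_numE//; last first.
  by apply: integral_ge0 => y _; apply: integral_ge0 => x _; rewrite lee_fin.
apply: le_lt_trans iA; apply: ae_ge0_le_integral => //.
- by move=> y _; apply: integral_ge0 => x _; rewrite lee_fin.
- by apply: (@measurable_fun_fubini_tonelli_G _ _ _ _ R m1 (EFin \o k)).
apply: filterS aeA => y + _; rewrite kI => Afin.
have -> : I y = A y `^ r by rewrite -poweRrM mulVf ?gt_eqF// poweRe1.
rewrite -(fineK Afin) poweR_EFin -EFinM lee_fin.
by apply: powRB1M_le => //; [rewrite fine_ge0|rewrite lerDl ltW].
Qed.

End integral_minkowski.

(** Minkowski's inequality for [u^p] with exponent [q / p > 1]: the norm with the larger exponent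
    may be moved from the inside to the outside. *)
Lemma mixed_norm_lty (R : realType) (d1 d2 : measure_display)
    (X : measurableType d1) (Y : measurableType d2)
    (m1 : {sigma_finite_measure set X -> \bar R})
    (m2 : {sigma_finite_measure set Y -> \bar R})
    (u : X * Y -> R) (w : Y -> R) (p q : R) :
    measurable_fun setT u -> (forall z, 0 <= u z) ->
    measurable_fun setT w -> (forall y, 0 < w y) ->
    (\int[m2]_y (w y)%:E < +oo)%E -> 0 < p < q ->
  (\int[m2]_y ((\int[m1]_x (u (x, y) `^ q)%:E) `^ (p / q)) < +oo ->
   \int[m1]_x ((\int[m2]_y (u (x, y) `^ p)%:E) `^ (q / p)) < +oo)%E.
Proof.
move=> mu u0 mw w0 iw /andP[p0 pq] H.
have pNq : p * (q / p) = q by rewrite mulrCA divff ?gt_eqF// mulr1.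
apply: (@integral_minkowski_lty R d1 d2 X Y m1 m2 (fun z => u z `^ p) w) => //.
- exact: (measurableT_comp (measurable_powR _)).
- by move=> z; exact: powR_ge0.
- by rewrite ltr_pdivlMr// mul1r.
rewrite invf_div; under eq_integral do under eq_integral do rewrite -powRrM pNq.
exact: H.
Qed.

(** * Measurability of the inverse and of integrals with a parameter *)

Lemma measurable_invr (R : realType) : measurable_fun setT (@GRing.inv R).
Proof.
(* Real powers are measurable on the whole line; squaring makes the base nonnegative, and at 0 the
   factor [x] restores the convention [0^-1 = 0]. *)
have -> : @GRing.inv R = (fun x => x * (x ^+ 2) `^ (-1)).
  apply/funext => x; rewrite powR_inv1 ?sqr_ge0//.
  have [->|x0] := eqVneq x 0; first by rewrite invr0 mul0r.
  by field.
apply: measurable_funM => //; apply: (measurableT_comp (measurable_powR _)).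
exact: measurable_funX.
Qed.

(** Tonelli's theorem gives measurability for the positive and the negative part; subtraction and
    [fine] preserve it. *)
Lemma measurable_Rintegral_param (R : realType) (d1 d2 : measure_display)
    (X : measurableType d1) (Y : measurableType d2)
    (m : {sigma_finite_measure set Y -> \bar R}) (u : X * Y -> R) :
  measurable_fun setT u -> measurable_fun setT (fun x => \int[m]_y u (x, y)).
Proof.
move=> mu; apply: measurableT_comp => //.
have mEu : measurable_fun setT (EFin \o u) by exact/measurable_EFinP.
under eq_fun do rewrite integralE.
apply: emeasurable_funB.
- have := @measurable_fun_fubini_tonelli_F _ _ X Y R m (EFin \o u)^\+%E.
  move=> /(_ (measurable_funepos mEu) (fun _ => funepos_ge0 _ _)).
  rewrite !unlock; exact.
- have := @measurable_fun_fubini_tonelli_F _ _ X Y R m (EFin \o u)^\-%E.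
  move=> /(_ (measurable_funeneg mEu) (fun _ => funeneg_ge0 _ _)).
  rewrite !unlock; exact.
Qed.

(** * Gaussian integrals and the size of the Ornstein-Uhlenbeck semigroup *)

(** The change of variables holds for the Radon-Nikodym derivative [D], and [D] is almost everywhere
    the Gaussian density since both have the same integral over every measurable set. *)
Lemma ge0_integral_gaussian (R : realType) (d : nat)
    (g : d.-tuple R -> \bar R) :
    (forall x, 0 <= g x)%E -> measurable_fun setT g ->
  (\int[gaussian_measure R d]_x g x =
   \int[lebesgue_tuple d]_x (g x * (gaussian_density x)%:E))%E.
Proof.
move=> g0 mg.
have mE : measurable_fun setT (EFin \o @gaussian_density R d).
  by apply/measurable_EFinP; exact: measurable_gaussian_density.
have dom : gaussian_measure R d `<< lebesgue_tuple d.
  apply/null_content_dominatesP => A mA A0; apply: null_set_integral => //.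
  exact: measurable_funTS.
pose D := Radon_Nikodym_SigmaFinite.f (gaussian_measure R d) (lebesgue_tuple d).
have iD := Radon_Nikodym_SigmaFinite.f_integrable dom.
have : ae_eq (lebesgue_tuple d) setT D (EFin \o @gaussian_density R d).
  apply: integral_ae_eq => // E _ mEE.
  by rewrite /D -Radon_Nikodym_SigmaFinite.f_integral.
move=> DE.
rewrite -(Radon_Nikodym_SigmaFinite.change_of_variables dom)//.
apply: ae_eq_integral => //.
- by apply: emeasurable_funM => //; exact: measurable_int iD.
- exact: emeasurable_funM.
- by apply: filterS DE => x /= H _; rewrite -[X in (_ * X)%E]/(D x) H.
Qed.

(** Multiplied by [1 - e^2], the difference of the two sides is in each coordinate the square of
    [tnth x i - e * tnth y i]. *)
Lemma mehler_exponent_le (R : realType) (d : nat) (e : R) (x y : d.-tuple R) :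
  0 < e < 1 ->
  - sqnorm (fun i => tnth y i - e * tnth x i) / (1 - e ^+ 2)
    <= sqnorm (tnth x) - sqnorm (tnth y).
Proof.
move=> /andP[e0 e1].
rewrite ler_pdivrMr; last by rewrite subr_gt0 expr_lt1// ltW.
rewrite /sqnorm -sumrB -sumrN mulr_suml; apply: ler_sum => i _.
rewrite -subr_ge0.
set a := tnth x i; set b := tnth y i.
have -> : (a ^+ 2 - b ^+ 2) * (1 - e ^+ 2) - - (b - e * a) ^+ 2
  = (a - e * b) ^+ 2 by ring.
exact: sqr_ge0.
Qed.

(** The Gaussian measure is finite, so [L^p] lies in [L^1]; the positive normalizing constant is
    then divided out. *)
Lemma Lfun_gaussian_lty (R : realType) (d : nat) (p : R) (f : d.-tuple R -> R) :
    1 <= p -> f \in Lfun (gaussian_measure R d) p%:E ->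
  (\int[lebesgue_tuple d]_x (`|f x| * expR (- sqnorm (tnth x)))%:E < +oo)%E.
Proof.
move=> p1 fp.
have /Lfun1_integrable/integrableP[/measurable_EFinP mf] :
    f \in Lfun (gaussian_measure R d) 1.
  apply: (@Lfun_subset _ _ _ (gaussian_measure R d) 1 p%:E) => //.
  exact: fin_num_measure.
rewrite ge0_integral_gaussian//; last first.
  by apply: measurableT_comp => //; exact/measurable_EFinP.
set c : R := pi `^ (- (d%:R / 2)).
have c0 : 0 < c by rewrite powR_gt0// pi_gt0.
under eq_integral => x _ do
  rewrite /= -EFinM /gaussian_density -/c mulrCA EFinM.
rewrite ge0_integralZl//.
- move=> H; rewrite ltNge leye_eq; apply/negP => /eqP E; move: H.
  by rewrite E gt0_muley// ltxx.
- apply/measurable_EFinP; apply: measurable_funM.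
    exact: measurableT_comp.
  do 2 apply: measurableT_comp => //.
  by apply: measurable_sum => i; apply: measurable_funX; exact: measurable_tnth.
- by rewrite lee_fin ltW.
Qed.

(** [mehler_exponent_le] with [e = expR (- s)] bounds the kernel by the Gaussian weight in [y] times
    [expR (sqnorm (tnth x))]. The constant is the [L^1(gamma_d)] norm of [f], so it depends on
    neither [s] nor [x]. *)
Lemma ornstein_uhlenbeck_bound (R : realType) (d : nat) (p : R)
    (f : d.-tuple R -> R) :
    1 <= p -> f \in Lfun (gaussian_measure R d) p%:E ->
  exists2 C : R, 0 <= C & forall s x, 0 < s ->
    `|ornstein_uhlenbeck s f x| <=
      (1 - expR (- 2 * s)) `^ (- (d%:R / 2)) * (expR (sqnorm (tnth x)) * C).
Proof.
move=> p1 fp; have := @Lfun_gaussian_lty R d p f p1 fp.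
set g := fun y : d.-tuple R => `|f y| * expR (- sqnorm (tnth y)) => gfin.
set c : R := pi `^ (- (d%:R / 2)).
have mf : measurable_fun setT f by move: fp; rewrite inE => /andP[/[!inE]].
have msq : measurable_fun setT (fun y : d.-tuple R => sqnorm (tnth y)).
  by apply: measurable_sum => i; apply: measurable_funX; exact: measurable_tnth.
have g0 y : 0 <= g y by rewrite mulr_ge0 ?expR_ge0.
have mg : measurable_fun setT g.
  apply: measurable_funM; first exact: measurableT_comp.
  by do 2 apply: measurableT_comp => //.
have ig : (lebesgue_tuple d).-integrable setT (EFin \o g).
  apply/integrableP; split; first exact/measurable_EFinP.
  by under eq_integral do rewrite gee0_abs ?lee_fin//.
exists (c * \int[lebesgue_tuple d]_y g y).
  by rewrite mulr_ge0 ?powR_ge0// Rintegral_ge0.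
move=> s x s0; rewrite /ornstein_uhlenbeck s0 -/c.
set k := fun y => expR _ * f y.
set v := 1 - expR (- 2 * s).
have s2 : expR (- 2 * s) = expR (- s) ^+ 2.
  by rewrite -expRM_natl mulrN mulNr.
have es : 0 < expR (- s) < 1 by rewrite expR_gt0 expR_lt1 oppr_lt0.
have kg y : `|k y| <= expR (sqnorm (tnth x)) * g y.
  rewrite /k normrM ger0_norm ?expR_ge0// /g mulrCA mulrC ler_wpM2l//.
  by rewrite -expRD ler_expR s2 mehler_exponent_le.
have mk : measurable_fun setT k.
  apply: measurable_funM => //; apply: measurableT_comp => //.
  apply: measurable_funM => //; apply: measurableT_comp => //.
  apply: measurable_sum => i; apply: measurable_funX.
  by apply: measurable_funB => //; exact: measurable_tnth.
have iEg : (lebesgue_tuple d).-integrable setT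
    (EFin \o (fun y => expR (sqnorm (tnth x)) * g y)).
  exact: (integrableZl measurableT (expR (sqnorm (tnth x))) ig).
have ik : (lebesgue_tuple d).-integrable setT (EFin \o k).
  apply: le_integrable iEg => //; first exact/measurable_EFinP.
  move=> y _; rewrite /= lee_fin (le_trans (kg y))// ler_norm//.
rewrite normrM ger0_norm ?mulr_ge0 ?powR_ge0//.
rewrite [leRHS](_ : _ = c * v `^ (- (d%:R / 2)) *
    (expR (sqnorm (tnth x)) * \int[lebesgue_tuple d]_y g y)); last by ring.
rewrite ler_wpM2l ?mulr_ge0 ?powR_ge0//.
rewrite -RintegralZl//; apply: le_trans (le_normr_Rintegral _ ik) _ => //.
apply: le_Rintegral => //; exact: integrable_norm.
Qed.

Lemma measurable_ornstein_uhlenbeck (R : realType) (d : nat)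
    (f : d.-tuple R -> R) : measurable_fun setT f ->
  measurable_fun setT (fun z : R * d.-tuple R => ornstein_uhlenbeck z.1 f z.2).
Proof.
move=> mf; apply: measurable_fun_ifT => //=.
- exact: measurable_fun_ltr.
- apply: measurable_funM; last first.
    pose u (z : (R * d.-tuple R) * d.-tuple R) :=
      expR (- sqnorm (fun i => tnth z.2 i - expR (- z.1.1) * tnth z.1.2 i)
               / (1 - expR (- 2 * z.1.1))) * f z.2.
    apply: (@measurable_Rintegral_param R _ _ _ _ (lebesgue_tuple d) u).
    have m11 : measurable_fun setT
        (fun z : (R * d.-tuple R) * d.-tuple R => z.1.1).
      exact: (measurableT_comp measurable_fst measurable_fst).
    have mexp c : measurable_fun setT
        (fun z : (R * d.-tuple R) * d.-tuple R => expR (c * z.1.1)).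
      by apply: measurableT_comp => //; exact: measurable_funM.
    apply: measurable_funM; last exact: measurableT_comp.
    apply: measurableT_comp => //; apply: measurable_funM.
      apply: measurableT_comp => //; apply: measurable_sum => i.
      apply: measurable_funX; apply: measurable_funB.
        exact: (measurableT_comp (measurable_tnth i)).
      apply: measurable_funM.
        under eq_fun do rewrite -mulN1r; exact: mexp.
      exact: (measurableT_comp (measurable_tnth i)
        (measurableT_comp measurable_snd measurable_fst)).
    apply: (measurableT_comp (@measurable_invr R)).
    by apply: measurable_funB => //; exact: mexp.
  apply: measurable_funM => //.
  apply: (measurableT_comp (measurable_powR _)).
  apply: measurable_funB => //; apply: measurableT_comp => //.
  exact: measurable_funM.
- exact: (measurableT_comp mf).
Qed.


(** * Bounds and derivatives of the subordination kernels *)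

Lemma is_derive_powR1D (R : realType) (a s : R) : 0 <= s ->
  is_derive s 1 (fun x : R => (1 + x) `^ a) (a * (1 + s) `^ (a - 1)).
Proof.
move=> s0; have s1 : 0 < 1 + s by rewrite ltr_pwDl.
have d1 : is_derive s 1 (fun x : R => 1 + x) 1.
  have := is_deriveD (is_derive_cst (1 : R^o) (s : R^o) 1)
    (is_derive_id (s : R^o) 1).
  by rewrite add0r.
have := @is_derive1_comp _ (fun x => x `^ a) (fun x => 1 + x) s _ _
  (is_derive1_powR a s1) d1.
by rewrite mulr1.
Qed.

(** Multiples of this function dominate all the integrals in [s] below. Its antiderivative
    [-2 (1 + s)^(-1/2)] vanishes at infinity. *)
Lemma integrable_powR1D (R : realType) :
  (@lebesgue_measure R).-integrable `]0%R, +oo[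
    (EFin \o (fun s => (1 + s) `^ (- (3 / 2)))).
Proof.
have mw : measurable_fun setT (fun s : R => (1 + s) `^ (- (3 / 2))).
  apply: (measurableT_comp (measurable_powR _)); exact: measurable_funD.
have dF (s : R) : 0 <= s ->
    is_derive s 1 (fun x => - 2 * (1 + x) `^ (- 2^-1)) ((1 + s) `^ (- (3 / 2))).
  move=> s0; have := is_deriveZ (- 2) (@is_derive_powR1D R (- 2^-1) s s0).
  rewrite /GRing.scale/= mulrA mulrNN divff ?pnatr_eq0// mul1r.
  by rewrite (_ : - 2^-1 - 1 = - (3 / 2) :> R)//; lra.
apply/integrableP; split.
  by apply/measurable_EFinP; exact: measurable_funTS.
under eq_integral do rewrite gee0_abs ?lee_fin ?powR_ge0//.
rewrite integral_itv_obnd_cbnd; last exact/measurable_EFinP/measurable_funTS.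
rewrite (@ge0_continuous_FTC2y _ _ (fun s => - 2 * (1 + s) `^ (- 2^-1)) _ 0)//.
- by rewrite addr0 powR1 ltry.
- by move=> x _; exact: powR_ge0.
- apply: derivable_within_continuous => x; rewrite in_itv/= andbT => x0.
  by have [] := @is_derive_powR1D R (- (3 / 2)) x x0.
- rewrite -[X in _ --> X](mulr0 (- 2)); apply: cvgMr.
  (* The power is rewritten as a square root, so that the limit follows from continuity of the root
     at 0. *)
  apply: (@cvg_trans _ (Num.sqrt ((1 + x)^-1) @[x --> +oo])).
    apply: near_eq_cvg; near=> s.
    have s0 : 0 <= 1 + s by rewrite addr_ge0//; near: s; exact: nbhs_pinfty_ge.
    by rewrite -powR12_sqrt ?invr_ge0// -(powR_inv1 s0) -powRrM mulN1r.
  rewrite -{1}(@sqrtr0 R).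
  apply: (@cvg_comp _ _ _ (fun s : R => (1 + s)^-1) Num.sqrt _ (nbhs (0 : R))).
    apply/gtr0_cvgV0.
      by near=> s; rewrite ltr_pwDl//; near: s; exact: nbhs_pinfty_ge.
    apply/cvgryPge => A; near=> s; rewrite ler_wpDl//; near: s.
  exact: sqrt_continuous.
- move=> x /ltW x0; by have [] := dF x x0.
- apply/cvg_at_right_filter; apply: cvgMr.
  have [dF0 _] := @is_derive_powR1D R (- 2^-1) 0 (lexx 0).
  by have /differentiable_continuous := iffLR (derivable1_diffP _ _) dF0.
- move=> x; rewrite in_itv/= andbT => /ltW x0; rewrite derive1E.
  by have [_ ->] := dF x x0.
Unshelve. all: by end_near. Qed.

Lemma exprn1D_le_expR (R : realType) (n : nat) (c : R) : 0 < c ->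
  exists2 C : R, 0 <= C & forall v, 0 <= v -> (1 + v) ^+ n <= C * expR (c * v).
Proof.
(* From [y <= expR y] with [y = b (1 + v)], the [n]-th power costs [n b <= c] in the exponent.
   Dividing by [n + 1] covers [n = 0]. *)
move=> c0; pose b := c / n.+1%:R.
have b0 : 0 < b by rewrite divr_gt0.
exists (b^-1 ^+ n * expR c) => [|v v0].
  by rewrite mulr_ge0 ?exprn_ge0 ?invr_ge0 ?expR_ge0// ltW.
have v1 : 0 <= b * (1 + v) by rewrite mulr_ge0 ?addr_ge0// ltW.
have -> : (1 + v) ^+ n = b^-1 ^+ n * (b * (1 + v)) ^+ n.
  by rewrite -exprMn mulKf// gt_eqF.
rewrite -[leRHS]mulrA ler_wpM2l//.
  by rewrite exprn_ge0// invr_ge0 ltW.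
rewrite -expRD -[X in X + c * v]mulr1 -mulrDr.
apply: (@le_trans _ _ (expR (b * (1 + v)) ^+ n)).
  rewrite lerXn2r ?nnegrE ?expR_ge0//.
  by apply: le_trans (expR_ge1Dx _); rewrite lerDr.
rewrite -expRM_natl ler_expR mulrA ler_wpM2r ?addr_ge0// /b.
by rewrite mulrCA ger_pMr// ler_pdivrMr// mul1r ler_nat.
Qed.

(* Up to the factor [t / (2 sqrt pi)], [subordinator_kernel 0] is
   [half_stable_density], and differentiating in [t] turns
   [subordinator_kernel j] into [- t / 2] times [subordinator_kernel j.+1]. *)
Definition subordinator_kernel {R : realType} (j : nat) (t s : R) : R :=
  expR (- t ^+ 2 / (4 * s)) / s `^ (3 / 2) * s^-1 ^+ j.

Lemma subordinator_kernel_ge0 (R : realType) (j : nat) (t s : R) :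
  0 <= s -> 0 <= subordinator_kernel j t s.
Proof.
move=> s0; rewrite mulr_ge0 ?exprn_ge0 ?invr_ge0//.
by rewrite divr_ge0 ?expR_ge0 ?powR_ge0.
Qed.

Lemma measurable_subordinator_kernel (R : realType) (j : nat) :
  measurable_fun setT (fun z : R * R => subordinator_kernel j z.1 z.2).
Proof.
apply: measurable_funM; last first.
  apply: measurable_funX; exact: (measurableT_comp (@measurable_invr R)).
apply: measurable_funM.
  apply: measurableT_comp => //; apply: measurable_funM.
    by apply: measurableT_comp => //; exact: measurable_funX.
  by apply: (measurableT_comp (@measurable_invr R)); exact: measurable_funM.
apply: (measurableT_comp (@measurable_invr R)).
exact: (measurableT_comp (measurable_powR _)).
Qed.

(** With [v = 1 / s], [s^(-3/2) = (1 + v)^(3/2) (1 + s)^(-3/2)]. Every other factor but the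
    exponential is at most a power of [1 + v], which [expR (- a^2 v / 4)] absorbs. The weight
    [(1 + 1/s)^N] allows for the growth of [T_s f] as [s] tends to 0. *)
Lemma subordinator_kernel_le (R : realType) (N j : nat) (a : R) : 0 < a ->
  exists2 C : R, 0 <= C & forall t s, a <= t -> 0 < s ->
    (1 + s^-1) ^+ N * subordinator_kernel j t s <= C * (1 + s) `^ (- (3 / 2)).
Proof.
move=> a0; have c0 : 0 < a ^+ 2 / 4 by rewrite divr_gt0// exprn_gt0.
(* The exponent collects [N] from the weight, [j] from [s^(-j)], and 2 from rounding up 3/2. *)
have [C C0 CP] := @exprn1D_le_expR R (N + j + 2) _ c0.
exists C => // t s at_ s0; set v := s^-1.
have v0 : 0 < v by rewrite invr_gt0.
have s1 : 0 < 1 + s by rewrite ltr_pwDl// ltW.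
have v1 : 0 < 1 + v by rewrite ltr_pwDl// ltW.
set W := (1 + s) `^ _; have W0 : 0 <= W by exact: powR_ge0.
have sW : (s `^ (3 / 2))^-1 = (1 + v) `^ (3 / 2) * W.
  have -> : 1 + v = s^-1 * (1 + s).
    by rewrite mulrDr mulr1 mulVf ?gt_eqF// addrC.
  rewrite powRM ?invr_ge0 ?ltW// /W powRN mulfK ?gt_eqF ?powR_gt0//.
  by rewrite -(powR_inv1 (ltW s0)) -powRrM mulN1r powRN.
have vW : (1 + v) `^ (3 / 2) <= (1 + v) ^+ 2.
  rewrite -(powR_mulrn 2 (ltW v1)) ler_powR//; first by rewrite lerDl ltW.
  by rewrite ler_pdivrMr//; lra.
have Ea : expR (- t ^+ 2 / (4 * s)) <= expR (- (a ^+ 2 / 4 * v)).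
  rewrite ler_expR mulNr lerN2 invfM -/v mulrA (ler_wpM2r (ltW v0))//.
  by rewrite ler_wpM2r ?invr_ge0// lerXn2r// nnegrE ltW// (lt_le_trans a0).
have vj : v ^+ j <= (1 + v) ^+ j.
  by rewrite lerXn2r ?nnegrE ?ltW// ltrDr.
rewrite /subordinator_kernel -/v sW.
apply: (@le_trans _ _ ((1 + v) ^+ N *
    (expR (- (a ^+ 2 / 4 * v)) * ((1 + v) ^+ 2 * W) * (1 + v) ^+ j))).
  have [v0' v1'] := (ltW v0, ltW v1).
  rewrite ler_wpM2l ?exprn_ge0//.
  apply: ler_pM; rewrite ?mulr_ge0 ?exprn_ge0 ?expR_ge0 ?powR_ge0//.
  by rewrite ler_pM ?mulr_ge0 ?expR_ge0 ?powR_ge0// ler_wpM2r.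
rewrite [leLHS](_ : _ =
    (1 + v) ^+ (N + j + 2) * expR (- (a ^+ 2 / 4 * v)) * W); last first.
  by rewrite !exprD; ring.
by rewrite ler_wpM2r// expRN ler_pdivrMr ?expR_gt0// CP// ltW.
Qed.

Lemma is_derive_subordinator_kernel (R : realType) (j : nat) (t s : R) :
  0 < s -> is_derive t 1 (fun u => subordinator_kernel j u s)
    (- (t / 2) * subordinator_kernel j.+1 t s).
Proof.
move=> s0; pose g (u : R) := - u ^+ 2 / (4 * s).
have dg : is_derive t 1 g (- (2 * t) / (4 * s)).
  have := is_derive_poly (- (4 * s)^-1 *: 'X^2) t.
  rewrite derivZ derivXn hornerZ hornerMn hornerXn expr1.
  have -> : - (4 * s)^-1 * (t *+ 2) = - (2 * t) / (4 * s) by ring.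
  congr is_derive; apply/funext => u; rewrite hornerZ hornerXn /g; ring.
have := is_deriveZ (s^-1 ^+ j / s `^ (3 / 2))
  (@is_derive1_comp _ expR g t _ _ (is_derive_expR _) dg).
rewrite /GRing.scale/=.
have -> : s^-1 ^+ j / s `^ (3 / 2) * (expR (g t) * (- (2 * t) / (4 * s))) =
    - (t / 2) * subordinator_kernel j.+1 t s.
  rewrite /subordinator_kernel -/(g t) exprS invfM; field.
  by rewrite !gt_eqF ?powR_gt0.
have -> // : (s^-1 ^+ j / s `^ (3 / 2)) \*: (expR \o g) =
    (fun u => subordinator_kernel j u s).
apply/funext => u; rewrite /subordinator_kernel -/(g u).
by rewrite -[LHS]/(s^-1 ^+ j / s `^ (3 / 2) * expR (g u)); ring.
Qed.

(** * Integrals against the kernels and their derivatives in time *)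

Section subordinated_integral.
Context {R : realType} {d : measure_display} {X : measurableType d}.
Variables (phi : R -> X -> R) (N : nat) (C : X -> R).
Hypothesis mphi : measurable_fun setT (fun z : R * X => phi z.1 z.2).
Hypothesis phiC : forall s x, 0 < s -> `|phi s x| <= C x * (1 + s^-1) ^+ N.

(** For [phi s x = T_s f(x)] this is the function [F_j(t, x)] introduced above. *)
Definition subordinated (j : nat) (t : R) (x : X) : R :=
  \int[lebesgue_measure]_(s in `]0%R, +oo[)
    (phi s x * subordinator_kernel j t s).

(** [M] is uniform in [t >= a], so that one majorant serves for integrability and for
    differentiation under the integral sign. *)
Let dominated j a x : 0 < a -> exists2 M : R, 0 <= M &
  forall t s, a <= t -> 0 < s ->
    `|phi s x * subordinator_kernel j t s| <= M * (1 + s) `^ (- (3 / 2)).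
Proof.
move=> a0; have [M M0 MP] := @subordinator_kernel_le R N j a a0.
exists (`|C x| * M) => [|t s at_ s0]; first by rewrite mulr_ge0.
rewrite normrM (ger0_norm (subordinator_kernel_ge0 _ _ _ _ (ltW s0))).
apply: (@le_trans _ _ (`|C x| * ((1 + s^-1) ^+ N * subordinator_kernel j t s))).
  rewrite [leRHS]mulrA ler_wpM2r//.
    by apply: subordinator_kernel_ge0; exact: ltW.
  apply: le_trans (phiC _ _ s0) _; rewrite ler_wpM2r ?ler_norm//.
  by rewrite exprn_ge0// addr_ge0// invr_ge0 ltW.
by rewrite -mulrA ler_wpM2l// MP.
Qed.

Let mintegrand j t x :
  measurable_fun setT (fun s => phi s x * subordinator_kernel j t s).
Proof.
apply: measurable_funM.
  exact: (measurableT_comp mphi (measurable_pair2 x)).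
exact: (measurableT_comp (measurable_subordinator_kernel R j)
  (measurable_pair1 t)).
Qed.

Let integrable_majorant (M : R) : (@lebesgue_measure R).-integrable `]0%R, +oo[
  (EFin \o (fun s => M * (1 + s) `^ (- (3 / 2)))).
Proof. exact: (integrableZl _ M (integrable_powR1D R)). Qed.

Lemma integrable_subordinated (j : nat) (t : R) (x : X) : 0 < t ->
  (@lebesgue_measure R).-integrable `]0%R, +oo[
    (EFin \o (fun s => phi s x * subordinator_kernel j t s)).
Proof.
move=> t0; have [M M0 MP] := dominated j t x t0.
apply: le_integrable (integrable_majorant M) => //.
  by apply/measurable_EFinP/measurable_funTS; exact: mintegrand.
move=> s /=; rewrite in_itv/= andbT => s0.
by rewrite lee_fin (le_trans (MP _ _ (lexx t) s0))// ler_norm.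
Qed.

Lemma measurable_subordinated (j : nat) :
  measurable_fun setT (fun z : R * X => subordinated j z.1 z.2).
Proof.
rewrite /subordinated; under eq_fun do rewrite Rintegral_mkcond.
pose u (z : (R * X) * R) := phi z.2 z.1.2 * subordinator_kernel j z.1.1 z.2 *
  \1_`]0%R, +oo[ z.2.
have mu : measurable_fun setT u.
  apply: measurable_funM; last first.
    by apply: (measurableT_comp (@measurable_indic _ _ R setT _ _)).
  apply: measurable_funM.
    have m1 : measurable_fun setT (fun z : (R * X) * R => (z.2, z.1.2)).
      apply/measurable_fun_pair => //.
      exact: (measurableT_comp measurable_snd measurable_fst).
    exact: (measurableT_comp mphi m1).
  have m2 : measurable_fun setT (fun z : (R * X) * R => (z.1.1, z.2)).
    apply/measurable_fun_pair => //.
    exact: (measurableT_comp measurable_fst measurable_fst).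
  exact: (measurableT_comp (measurable_subordinator_kernel R j) m2).
have := @measurable_Rintegral_param R _ _ _ _ lebesgue_measure u mu.
congr measurable_fun; apply/funext => z.
apply: eq_Rintegral => s _; rewrite /u patchE indicE.
by case: ifPn; rewrite ?mulr1 ?mulr0.
Qed.

Lemma is_derive_subordinated (j : nat) (t : R) (x : X) : 0 < t ->
  is_derive t 1 (subordinated j ^~ x) (- (t / 2) * subordinated j.+1 t x).
Proof.
move=> t0; have t2 : 0 < t / 2 by rewrite divr_gt0.
pose f (u s : R) := phi s x * subordinator_kernel j u s.
have df (u s : R) : 0 < s -> is_derive u 1 (f ^~ s)
    (- (u / 2) * (phi s x * subordinator_kernel j.+1 u s)).
  move=> s0; rewrite mulrCA.
  exact: (is_deriveZ (phi s x) (is_derive_subordinator_kernel _ j u s s0)).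
have pf (u s : R) : 0 < s ->
    partial1of2 f u s = - (u / 2) * (phi s x * subordinator_kernel j.+1 u s).
  by move=> s0; rewrite partial1of2E; have [_ ->] := df u s s0.
have [M M0 MP] := dominated j.+1 (t / 2) x t2.
(* On the neighbourhood []t/2, t+1[] of [t], [(t + 1) / 2] bounds the factor [u / 2] of the
   derivative, and [M] bounds the rest because [u >= t / 2]. *)
pose G (s : R) := (t + 1) / 2 * M * (1 + s) `^ (- (3 / 2)).
have c0 : 0 <= (t + 1) / 2 by rewrite divr_ge0// addr_ge0// ltW.
have mB : measurable (`]0%R, +oo[%classic : set R) by [].
have It : `](t / 2), (t + 1)[%classic t.
  by rewrite /= in_itv/= ltrDl ltr01 andbT ltr_pdivrMr// ltr_pMr// ltr1n.
have intf (u : R) : `](t / 2), (t + 1)[%classic u ->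
    (@lebesgue_measure R).-integrable `]0%R, +oo[ (EFin \o f u).
  rewrite /= in_itv/= => /andP[tu _]; apply: integrable_subordinated.
  exact: lt_trans tu.
have derf (u s : R) : `](t / 2), (t + 1)[%classic u -> `]0, +oo[%classic s ->
    derivable (f ^~ s) u 1.
  by move=> _; rewrite /= in_itv/= andbT => s0; have [] := df u s s0.
have G0 s : 0 <= G s by exact: mulr_ge0 (mulr_ge0 c0 M0) (powR_ge0 _ _).
have GP (u s : R) : `](t / 2), (t + 1)[%classic u -> `]0, +oo[%classic s ->
    `|partial1of2 f u s| <= G s.
  rewrite /= !in_itv/= andbT => /andP[tu ut] s0; rewrite pf// normrM /G -mulrA.
  have u0 : 0 < u by exact: lt_trans tu.
  apply: ler_pM => //; last exact: MP (ltW tu) s0.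
  by rewrite normrN gtr0_norm ?divr_gt0// ler_pM2r ?invr_gt0// ltW.
have iG := integrable_majorant ((t + 1) / 2 * M).
apply: DeriveDef.
  exact: (@derivable_under_integral R _ _ lebesgue_measure f _ mB
    t _ _ It intf derf G G0 iG GP).
rewrite -derive1E.
rewrite (@differentiation_under_integral R _ _ lebesgue_measure f _ mB
    t _ _ It intf derf G G0 iG GP).
rewrite -RintegralZl//; last exact: integrable_subordinated.
by apply: eq_Rintegral => s; rewrite inE/= in_itv/= andbT => s0; rewrite pf.
Qed.

End subordinated_integral.

Section subordinated_polynomial.
Context {R : realType} {d : measure_display} {X : measurableType d}.
Variables (phi : R -> X -> R) (N : nat) (C : X -> R).
Hypothesis mphi : measurable_fun setT (fun z : R * X => phi z.1 z.2).
Hypothesis phiC : forall s x, 0 < s -> `|phi s x| <= C x * (1 + s^-1) ^+ N.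

(** Finite sums of the [F_j] with polynomial coefficients in [t]. The class is closed under
    differentiation in [t], so the [k]-th derivative need not be written out. *)
Inductive subordinated_poly : (R -> X -> R) -> Prop :=
| subordinated_term (p : {poly R}) (j : nat) :
    subordinated_poly (fun t x => p.[t] * subordinated phi j t x)
| subordinated_add (F G : R -> X -> R) :
    subordinated_poly F -> subordinated_poly G ->
    subordinated_poly (fun t x => F t x + G t x).

Lemma measurable_subordinated_poly F : subordinated_poly F ->
  measurable_fun setT (fun z : R * X => F z.1 z.2).
Proof.
elim=> {F} [p j|F G _ mF _ mG]; last exact: measurable_funD.
apply: measurable_funM; last exact: (measurable_subordinated phi mphi).
apply: (measurableT_comp _ measurable_fst).
apply: continuous_measurable_fun; exact: continuous_horner.
Qed.

Lemma is_derive_subordinated_poly F : subordinated_poly F ->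
  exists2 F', subordinated_poly F' &
    forall (t : R) (x : X), 0 < t -> is_derive t 1 (F ^~ x) (F' t x).
Proof.
elim=> {F} [p j|F G _ [F' sF dF] _ [G' sG dG]]; last first.
  exists (fun t x => F' t x + G' t x); first exact: subordinated_add.
  by move=> t x t0; exact: is_deriveD (dF t x t0) (dG t x t0).
(* Product rule: the second coefficient is [- (t / 2) p(t)], from [dF_j/dt = - (t / 2) F_(j+1)]. *)
exists (fun t x => p^`().[t] * subordinated phi j t x +
    (- 2^-1 *: (p * 'X)).[t] * subordinated phi j.+1 t x).
  by apply: subordinated_add; exact: subordinated_term.
move=> t x t0.
have := is_deriveM (is_derive_poly p t)
  (is_derive_subordinated phi N C mphi phiC j t x t0).
rewrite /GRing.scale/= => H.
rewrite [X in is_derive _ _ _ X](_ : _ =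
  p.[t] * (- (t / 2) * subordinated phi j.+1 t x) +
  subordinated phi j t x * p^`().[t])//.
rewrite hornerZ hornerM hornerX; ring.
Qed.

Lemma derive1n_subordinated_poly (k : nat) (u F : R -> X -> R) :
    subordinated_poly F -> (forall t x, 0 < t -> u t x = F t x) ->
  exists2 G, subordinated_poly G &
    forall t x, 0 < t -> derive1n k (u ^~ x) t = G t x.
Proof.
move=> sF uF; elim: k => [|k [G sG uG]]; first by exists F.
have [G' sG' dG] := is_derive_subordinated_poly G sG.
exists G' => // t x t0; rewrite derive1nS derive1E.
(* The induction hypothesis holds only for positive times, hence throughout a neighbourhood of [t],
   which determines the derivative at [t]. *)
have [_ <-] := dG t x t0; apply: near_eq_derive.
by near=> v; apply: uG; near: v; exact: lt_nbhsr.
Unshelve. all: by end_near. Qed.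

End subordinated_polynomial.

(** * Joint measurability of the time derivatives of the Poisson-Hermite semigroup *)

Lemma measurable_dt_poisson_hermite (R : realType) (d k : nat) (p : R)
    (f : d.-tuple R -> R) :
    1 <= p -> f \in Lfun (gaussian_measure R d) p%:E ->
  exists2 G : R -> d.-tuple R -> R,
    measurable_fun setT (fun z : R * d.-tuple R => G z.1 z.2) &
    forall t x, 0 < t -> dt_poisson_hermite k f t x = G t x.
Proof.
move=> p1 fp; have [C C0 CP] := @ornstein_uhlenbeck_bound R d p f p1 fp.
have mf : measurable_fun setT f by move: fp; rewrite inE => /andP[/[!inE]].
pose phi s x := ornstein_uhlenbeck s f x.
have mphi := measurable_ornstein_uhlenbeck R d f mf.
(* From [expR (- 2 s) <= 1 / (1 + 2 s)] follows [1 / (1 - expR (- 2 s)) <= 1 + 1 / (2 s) <= 1 + 1 /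
   s]. As this base is at least 1, the exponent [d / 2] may be raised to the integer [d]. *)
have phiC s x : 0 < s ->
    `|phi s x| <= expR (sqnorm (tnth x)) * C * (1 + s^-1) ^+ d.
  move=> s0; apply: le_trans (CP s x s0) _.
  rewrite mulrC ler_wpM2l ?mulr_ge0 ?expR_ge0//.
  have s2 : 0 < 1 + 2 * s by rewrite ltr_pwDl// mulr_ge0// ltW.
  have v0 : 0 < 1 - expR (- 2 * s).
    by rewrite subr_gt0 expR_lt1 mulNr oppr_lt0 mulr_gt0.
  have s1 : 1 <= 1 + s^-1 by rewrite lerDl invr_ge0 ltW.
  have vs : (1 - expR (- 2 * s))^-1 <= 1 + s^-1.
    have ve : expR (- 2 * s) <= (1 + 2 * s)^-1.
      by rewrite mulNr expRN lef_pV2 ?posrE ?expR_gt0// expR_ge1Dx.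
    apply: (@le_trans _ _ ((1 - (1 + 2 * s)^-1)^-1)).
      rewrite lef_pV2 ?posrE// ?lerD2l ?lerN2// subr_gt0 invf_lt1//.
      by rewrite ltrDl mulr_gt0.
    have -> : (1 - (1 + 2 * s)^-1)^-1 = 1 + (2 * s)^-1.
      have -> : 1 - (1 + 2 * s)^-1 = 2 * s / (1 + 2 * s).
        by field; rewrite gt_eqF.
      by rewrite invf_div; field; rewrite gt_eqF.
    by rewrite lerD2l lef_pV2 ?posrE ?mulr_gt0// ler_pMl// ler1n.
  rewrite powRN -powR_inv1; last exact: powR_ge0.
  rewrite powRAC (powR_inv1 (ltW v0)) -powR_mulrn; last exact: le_trans s1.
  apply: (@le_trans _ _ ((1 + s^-1) `^ (d%:R / 2))).
    by apply: ge0_ler_powR => //;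
      rewrite nnegrE ?invr_ge0 1?ltW// (lt_le_trans _ s1).
  by apply: ler_powR => //; rewrite ler_pdivrMr// ler_peMr// ler1n.
have uF t x : 0 < t -> poisson_hermite t f x =
    ((2 * Num.sqrt pi)^-1 *: 'X).[t] * subordinated phi 0 t x.
  move=> t0; rewrite /poisson_hermite t0 hornerZ hornerX.
  rewrite /subordinated -RintegralZl//; last first.
    exact: (integrable_subordinated phi _ _ mphi phiC).
  apply: eq_Rintegral => s _; rewrite /half_stable_density /subordinator_kernel.
  by rewrite expr0 /phi; ring.
have [G sG GP] := @derive1n_subordinated_poly R _ _ phi _ _ mphi phiC k _ _
  (subordinated_term phi _ 0) uF.
by exists G => //; exact: measurable_subordinated_poly mphi _ sG.
Qed.

(** * The two conditions as mixed norms of one function *)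

Section weighted_mixed_norm.
Context {R : realType} {d : measure_display} {X : measurableType d}.
Variables (m : {sigma_finite_measure set X -> \bar R}) (b p q : R).
Variables (D G : R -> X -> R).
Hypothesis mG : measurable_fun setT (fun z : R * X => G z.1 z.2).
Hypothesis DG : forall t x, 0 < t -> D t x = G t x.
Hypotheses (p0 : 0 < p) (q0 : 0 < q).

(* The factor [t `^ (- q^-1)] turns the measure [dt / t] into [dt]. *)
Definition weighted_abs (z : R * X) : R :=
  z.1 `^ b * z.1 `^ (- q^-1) * `|G z.1 z.2| * \1_(`]0%R, +oo[%classic) z.1.

Lemma weighted_abs_ge0 z : 0 <= weighted_abs z.
Proof. by rewrite !mulr_ge0 ?powR_ge0. Qed.

Lemma measurable_weighted_abs : measurable_fun setT weighted_abs.
Proof.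
apply: measurable_funM; last first.
  exact: (measurableT_comp (@measurable_indic _ _ R setT _ _) measurable_fst).
apply: measurable_funM; last exact: measurableT_comp.
by apply: measurable_funM;
  exact: (measurableT_comp (measurable_powR _) measurable_fst).
Qed.

Let weighted_absE t x : 0 < t ->
  weighted_abs (t, x) = t `^ b * t `^ (- q^-1) * `|D t x|.
Proof.
move=> t0; rewrite /weighted_abs /= DG// indicE mem_set ?mulr1//=.
by rewrite in_itv/= t0.
Qed.

Let weighted_abs0 t x : ~ (0 < t) -> weighted_abs (t, x) = 0.
Proof.
move=> t0; rewrite /weighted_abs /= indicE memNset ?mulr0//=.
by rewrite in_itv/= andbT.
Qed.

Let powR_weight t : 0 < t -> t `^ (- q^-1) `^ q = t^-1.
Proof.
by move=> t0; rewrite -powRrM mulNr mulVf ?gt_eqF// powR_inv1// ltW.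
Qed.

Local Open Scope ereal_scope.

Lemma integral_weighted_abs x :
  \int[lebesgue_measure]_(t in `]0%R, +oo[)
    (((t `^ b * `|D t x|)%:E `^ q) * (t^-1)%:E) =
  \int[lebesgue_measure]_t (weighted_abs (t, x) `^ q)%:E.
Proof.
rewrite integral_mkcond; apply: eq_integral => t _; rewrite patchE.
case: ifPn => [|/negP]; rewrite inE/= in_itv/= andbT => t0; last first.
  by rewrite weighted_abs0// powR0// gt_eqF.
rewrite weighted_absE// -EFinM; congr EFin.
by rewrite !powRM ?mulr_ge0 ?powR_ge0// powR_weight//; ring.
Qed.

Lemma integral_Lnorm_weighted_abs :
  \int[lebesgue_measure]_(t in `]0%R, +oo[)
    (((t `^ b)%:E * 'N[m]_p%:E[EFin \o D t]) `^ q * (t^-1)%:E) =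
  \int[lebesgue_measure]_t
    ((\int[m]_x (weighted_abs (t, x) `^ p)%:E) `^ (q / p)).
Proof.
rewrite integral_mkcond; apply: eq_integral => t _; rewrite patchE.
case: ifPn => [|/negP]; rewrite inE/= in_itv/= andbT => t0; last first.
  under eq_integral do rewrite weighted_abs0// powR0 ?gt_eqF//.
  by rewrite integral0 poweR0r// mulf_neq0 ?invr_eq0 ?gt_eqF.
have mGt : measurable_fun setT (G t).
  exact: (measurableT_comp mG (measurable_pair1 t)).
(* [c] does not depend on [x]: [c^p] leaves the inner integral, and its power [q / p] is
   [c^q = (t^b)^q / t]. *)
pose c : R := (t `^ b * t `^ (- q^-1))%R.
have c0 : (0 <= c)%R by rewrite mulr_ge0 ?powR_ge0.
have -> : \int[m]_x (weighted_abs (t, x) `^ p)%:E =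
    (c `^ p)%:E * \int[m]_x (`|D t x| `^ p)%:E.
  rewrite -ge0_integralZl//.
  - apply: eq_integral => x _; rewrite weighted_absE// -/c powRM//.
  - apply/measurable_EFinP; apply: (measurableT_comp (measurable_powR _)).
    apply: measurableT_comp => //.
    by rewrite (_ : D t = G t)//; apply/funext => x; rewrite DG.
  - by rewrite lee_fin powR_ge0.
rewrite unlock /= poweRM ?lee_fin ?powR_ge0//; last exact: poweR_ge0.
rewrite [in RHS]poweRM ?lee_fin ?powR_ge0//; last first.
  by apply: integral_ge0 => x _; rewrite lee_fin powR_ge0.
rewrite -poweRrM (mulrC p^-1)%R muleAC; congr (_ * _).
rewrite !poweR_EFin -EFinM; congr EFin.
rewrite -[RHS]powRrM mulrCA divff ?gt_eqF// mulr1.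
by rewrite /c powRM ?powR_ge0// powR_weight.
Qed.

End weighted_mixed_norm.

(** The same [u] serves for both spaces. The outermost exponents [1/q] and [1/p] are dropped, since
    a positive power does not affect finiteness. *)
Lemma besov_triebel_mixed_norm (R : realType) (d : nat) (alpha p q : R)
    (f : d.-tuple R -> R) :
    1 <= p -> 0 < q -> f \in Lfun (gaussian_measure R d) p%:E ->
  exists u : R * d.-tuple R -> R,
    [/\ measurable_fun setT u, forall z, 0 <= u z,
      @besov_lipschitz R d alpha p%:E q f <->
      (\int[lebesgue_measure]_t
         ((\int[gaussian_measure R d]_x (u (t, x) `^ p)%:E) `^ (q / p))
         < +oo)%E
    & @triebel_lizorkin R d alpha p q f <->
      (\int[gaussian_measure R d]_x
         ((\int[lebesgue_measure]_t (u (t, x) `^ q)%:E) `^ (p / q))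
         < +oo)%E].
Proof.
move=> p1 q0 fp; set k := smoothness_order alpha.
have p0 : 0 < p by exact: lt_le_trans p1.
have [G mG DG] := @measurable_dt_poisson_hermite R d k p f p1 fp.
have lty_poweR (x : \bar R) (r : R) : 0 < r -> (x `^ r < +oo <-> x < +oo)%E.
  by move=> r0; split; [apply: lty_poweRy; rewrite gt_eqF|exact: poweR_lty].
exists (weighted_abs (k%:R - alpha) q G); split.
- exact: measurable_weighted_abs.
- exact: weighted_abs_ge0.
- rewrite -(integral_Lnorm_weighted_abs _ (k%:R - alpha) _ _ _ _ mG DG p0 q0).
  rewrite /besov_lipschitz /= -/k lty_poweR ?invr_gt0//.
  by split => [[]//|H]; split.
- under [X in _ <-> (X < _)%E]eq_integral => x _.
    rewrite -(@integral_weighted_abs _ _ _ (k%:R - alpha) q _ G DG q0).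
    rewrite (mulrC p) poweRrM.
    over.
  rewrite /triebel_lizorkin /= -/k unlock /= lty_poweR ?invr_gt0//.
  under eq_integral do rewrite gee0_abs ?poweR_ge0//.
  by split => [[]//|H]; split.
Qed.

Theorem proposition2p3 (R : realType) (d : nat) (alpha p q : R)
    (alpha_ge0 : 0 <= alpha) (p_gt1 : 1 < p) (q_gt1 : 1 < q) :
  [/\ p = q ->
        @triebel_lizorkin R d alpha p p = @besov_lipschitz R d alpha p%:E p,
      p < q ->
        @triebel_lizorkin R d alpha p q `<=` @besov_lipschitz R d alpha p%:E q
    & q < p ->
        @besov_lipschitz R d alpha p%:E q `<=` @triebel_lizorkin R d alpha p q].
Proof.
have p0 : 0 < p by exact: lt_trans p_gt1.
have q0 : 0 < q by exact: lt_trans q_gt1.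
have pLfun := @besov_triebel_mixed_norm R d alpha p _ _ (ltW p_gt1).
split.
- move=> _; apply/seteqP.
  suff H f : f \in Lfun (gaussian_measure R d) p%:E ->
      @triebel_lizorkin R d alpha p p f <->
      @besov_lipschitz R d alpha p%:E p f.
    by split=> f /[dup] fH [fp _]; apply/H.
  move=> fp; have [u [mu u0 -> ->]] := pLfun p f p0 fp.
  have mup : measurable_fun setT (fun z => (u z `^ p)%:E).
    apply/measurable_EFinP; exact: (measurableT_comp (measurable_powR _)).
  (* For [p = q] the exponents [q / p] and [p / q] are 1, and both sides are iterated integrals of
     [u^p]. *)
  rewrite divff ?gt_eqF//.
  have up0 z : (0 <= (u z `^ p)%:E)%E by rewrite lee_fin powR_ge0.
  under eq_integral do rewrite poweRe1 1?integral_ge0//.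
  under [X in _ <-> (X < _)%E]eq_integral do rewrite poweRe1 1?integral_ge0//.
  by rewrite (@fubini_tonelli _ _ _ _ R lebesgue_measure (gaussian_measure R d)
    (fun z => (u z `^ p)%:E)).
- move=> pq f /[dup] fF [fp _]; move: fF.
  have [u [mu u0 -> ->]] := pLfun q f q0 fp.
  (* The norm in [t], with the larger exponent [q], moves outside. The weight 1 is integrable for a
     probability measure. *)
  apply: (mixed_norm_lty R _ _ _ _ lebesgue_measure (gaussian_measure R d) u
    (cst 1)) => //; last by rewrite p0.
  rewrite [X in (X < _)%E](@integral_cst _ _ _
    (gaussian_measure R d) _ _ 1%E)//.
  by rewrite mul1e
    [X in (X < _)%E](probability_setT (gaussian_measure R d)) ltry.
- move=> qp f /[dup] fB [fp _]; move: fB.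
  have [u [mu u0 -> ->]] := pLfun q f q0 fp.
  (* The variables and the exponents trade places. Lebesgue measure being infinite, the positive
     integrable weight is now [gauss_fun]. *)
  apply: (mixed_norm_lty R _ _ _ _ (gaussian_measure R d) lebesgue_measure
    (fun z => u (z.2, z.1)) gauss_fun) => //.
  + by apply: (measurableT_comp mu); exact: measurable_swap.
  + exact: measurable_gauss_fun.
  + by move=> t; exact: expR_gt0.
  + by rewrite integralT_gauss ltry.
  + by rewrite q0.
Qed.
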